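(* Let $w_1,\dots,w_n$ be positive integers, let $d=\sum_{i=1}^n w_i$, and assume $w_i\mid d$ for all $i$ and $\gcd(w_1,\dots,w_n)=1$. Let $1\le k\le n$ and let $\beta\in\mathcal{M}=\mathcal{M}(w_1,\dots,w_n)$ satisfy $l(\beta)=1$ and $\beta_{k+1}=\dots=\beta_n=0$. Then, for any tuple that occurs as the last $(n-k)$ entries of an element of $\mathcal{M}$, the number of elements of $\mathcal{M}$ which share these same last $(n-k)$ entries is precisely $$\frac{\gcd(w_1,\dots,w_k)}{d}\prod_{i=1}^k\frac{d}{w_i},$$ and the number of strong $\beta$-classes with these last $(n-k)$ entries is $$T_\beta=\frac{\gcd(w_1,\dots,w_k)}{d}\,\frac{\gcd(\beta_1w_1,\dots,\beta_kw_k)}{d}\prod_{i=1}^k\frac{d}{w_i}.$$ If $\beta_i\neq0$ for all $1\le i\le k$, then $T_\beta$ coincides with the total number of singularities in each singular fibre of the $1$-parameter family of hypersurfaces in $\mathbb{P}_{w_1,\dots,w_n}$ over $\mathbb{A}^1_{\mathbb{C}}$ (with parameter $a$) given by $$F=\left(\sum_{i=1}^{n}x_i^{\frac{d}{w_i}}\right)+a\cdot\prod_{i=1}^{k}x_i^{\beta_i}.$$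
   Context: $\mathcal{M}(w_1,\dots,w_n)$ is the set of exponent tuples $\mathbf{x}=(x_1,\dots,x_n)$, where the $i$-th entry is taken modulo $\frac{d}{w_i}$ (represented by an integer $0\le x_i\le\frac{d}{w_i}-1$), such that the weighted degree $\sum_{i=1}^n x_iw_i$ is an integer multiple of $d$; write $l(\mathbf{x}):=\frac1d\sum_i x_iw_i$ (computed with the representatives $0\le x_i\le\frac{d}{w_i}-1$). For $\beta\in\mathcal{M}$ with $l(\beta)=1$, define the equivalence relation $\mathbf{x}\sim_\beta\mathbf{y}$ on $\mathcal{M}$ if and only if $\mathbf{y}=\mathbf{x}+t\beta$ for some $t\in\mathbb{Z}$ (the $i$-th entry taken modulo $\frac{d}{w_i}$). Its equivalence classes are the strong $\beta$-classes; if $\beta_{k+1}=\dots=\beta_n=0$, all elements of a strong $\beta$-class have the same last $(n-k)$ entries. $\mathbb{P}_{w_1,\dots,w_n}$ is the weighted projective space $(\mathbb{C}^n\setminus\{0\})/\mathbb{C}^*$, where $\lambda\in\mathbb{C}^*$ acts by $\lambda\cdot(x_1,\dots,x_n)=(\lambda^{w_1}x_1,\dots,\lambda^{w_n}x_n)$. The fibre over $a\in\mathbb{C}$ is $\{F_a=0\}\subset\mathbb{P}_{w_1,\dots,w_n}$. Singularities are understood via the affine cone: a singularity of the fibre over $a$ is a point of $\mathbb{P}_{w_1,\dots,w_n}$ at which all partial derivatives $\partial F_a/\partial x_i$, $1\le i\le n$, vanish; a fibre is singular if it has at least one singularity. *)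

(* Defs.v *)
From HB Require Import structures.
From mathcomp Require Import all_boot all_order all_algebra.
From mathcomp Require Import generic_quotient finmap.
From mathcomp Require Import boolp classical_sets functions cardinality reals.
From mathcomp Require Import complex mpoly.

Set Implicit Arguments.
Unset Strict Implicit.
Unset Printing Implicit Defensive.

Import Order.TTheory GRing.Theory Num.Theory.

Local Open Scope ring_scope.
Local Open Scope quotient_scope.
Local Open Scope complex_scope.

Section ExponentTuples.
Variables (n : nat) (w : 'I_n -> nat).

Definition wdeg : nat := (\sum_(i < n) w i)%N.

(* Entry i is an integer modulo d / w_i, given by its representative in
   [0, d / w_i - 1]. *)
Definition exptuple : finType := {dffun forall i : 'I_n, 'I_(wdeg %/ w i)}.

Definition wsum (x : exptuple) : nat := (\sum_(i < n) x i * w i)%N.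

Definition expM : {set exptuple} := [set x | wdeg %| wsum x]%N.

(* The division is exact on expM. *)
Definition lweight (x : exptuple) : nat := (wsum x %/ wdeg)%N.

Definition strong_equiv (beta x y : exptuple) : Prop :=
  exists t : int, forall i : 'I_n,
    ((y i)%:Z = (x i)%:Z + t * (beta i)%:Z %[mod (wdeg %/ w i)%N%:Z])%Z.

Definition strong_classes (beta : exptuple) : {set {set exptuple}} :=
  equivalence_partition (fun x y => `[< strong_equiv beta x y >]) expM.

(* Indices are 0-based: the entries x_(k+1), ..., x_n are those with k <= i. *)
Definition last_entries (k : nat) (x : exptuple) : seq nat :=
  drop k [seq (x i : nat) | i : 'I_n].

Definition gcd_first (k : nat) (u : 'I_n -> nat) : nat :=
  \big[gcdn/0%N]_(i < n | (i < k)%N) u i.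

Definition prod_first (k : nat) : rat :=
  \prod_(i < n | (i < k)%N) (wdeg%:R / (w i)%:R).

Definition T_beta (k : nat) (beta : exptuple) : rat :=
  (gcd_first k w)%:R / wdeg%:R
  * ((gcd_first k (fun i => beta i * w i)%N)%:R / wdeg%:R)
  * prod_first k.

End ExponentTuples.

Section WeightedProjectiveSpace.
Variables (C : fieldType) (n : nat) (w : 'I_n -> nat).

Definition punctured : choiceType := {v : 'rV[C]_n | v != 0}.

Definition wproj_equiv (u v : punctured) : bool :=
  `[< exists lambda : C, lambda != 0 /\
        forall i, \val v 0 i = lambda ^+ w i * \val u 0 i >].

Lemma wproj_equiv_refl : reflexive wproj_equiv.
Proof.
move=> u; apply/asboolP; exists 1; split; first exact: oner_neq0.
by move=> i; rewrite expr1n mul1r.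
Qed.

Lemma wproj_equiv_sym : ssrbool.symmetric wproj_equiv.
Proof.
suff H u v : wproj_equiv u v -> wproj_equiv v u.
  by move=> u v; apply/idP/idP; apply: H.
move=> /asboolP[l [l0 uv]]; apply/asboolP; exists l^-1; split.
  by rewrite invr_eq0.
by move=> i; rewrite uv mulrA -exprMn mulVf // expr1n mul1r.
Qed.

Lemma wproj_equiv_trans : transitive wproj_equiv.
Proof.
move=> v u x /asboolP[l [l0 uv]] /asboolP[m [m0 vx]].
apply/asboolP; exists (m * l); split; first by rewrite mulf_neq0.
by move=> i; rewrite vx uv mulrA exprMn.
Qed.

Canonical wproj_equiv_rel :=
  EquivRel wproj_equiv wproj_equiv_refl wproj_equiv_sym wproj_equiv_trans.

Definition wproj : choiceType := {eq_quot wproj_equiv_rel}.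

Definition wproj_pi (v : punctured) : wproj := \pi_({eq_quot wproj_equiv_rel}) v.

(* Singular points of the affine cone: for a quasi-homogeneous F the condition
   does not depend on the representative v of the point p, and over a field of
   characteristic 0 it implies F = 0 at p by Euler's identity. *)
Definition singularities (F : {mpoly C[n]}) : set wproj :=
  [set p | forall v : punctured, wproj_pi v = p ->
           forall i : 'I_n, (mderiv i F).@[\val v 0] = 0]%classic.

Definition hypersurface_family (k : nat) (beta : exptuple w) (a : C) :
    {mpoly C[n]} :=
  \sum_(i < n) 'X_i ^+ (wdeg w %/ w i)
  + a *: \prod_(i < n | (i < k)%N) 'X_i ^+ (beta i).

End WeightedProjectiveSpace.

Arguments singularities [C n] w F.

(* Main.v *)
Require Import Defs.
From mathcomp Require Import all_boot all_order all_algebra all_fingroup.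
From mathcomp Require Import cyclic separable cyclotomic.
From mathcomp Require Import generic_quotient finmap.
From mathcomp Require Import boolp classical_sets functions cardinality reals.
From mathcomp Require Import complex mpoly ring.

(* Sending x to (x_i w_i)_i identifies exponent tuples with the elements of
   (Z/d)^n whose i-th entry lies in w_i Z/d.  On the tuples supported on i < k,
   the pairing x |-> sum_i x_i w_i c_i has image generated by gcd(c_i w_i), so
   each of its nonempty fibres has gcd(c_i w_i)/d * prod d/w_i elements; a tuple
   u in its kernel has order d/gcd(u_i w_i), whence the number of orbits of
   translation by u on a fibre.  Taking c = 1 and u = beta counts the strong
   beta-classes.

   A singular point satisfies m_i x_i^m_i = - a beta_i P(x) for all i, where
   m_i = d/w_i and P(x) = prod x_i^beta_i, so its coordinates with i < k are
   nonzero and the others vanish.  After rescaling so that P takes the same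
   value at two singular points, they differ by roots of unity omega^(e_i w_i),
   omega a primitive d-th root of 1, with sum_i e_i w_i beta_i = 0 mod d; and
   e, e' give the same point exactly when they differ by a multiple of
   (1, ..., 1, 0, ..., 0).  This is the same count with c = beta and u = 1, the
   roles of the two gcds being exchanged. *)

Set Implicit Arguments.
Unset Strict Implicit.
Unset Printing Implicit Defensive.

Import Order.TTheory GRing.Theory Num.Theory.

Local Open Scope ring_scope.

(** * Uniform fibres, and subgroups of ['Z_p] generated by integers *)

(** Double counting of the pairs formed by a value and an element mapped to it. The values are
    listed without repetition rather than collected in a finite set type, because [f] will also take
    values in [wproj], which is not a finite type. *)
Lemma size_undup_uniform (T : finType) (U : eqType) (A : {set T}) (f : T -> U)
    (N : nat) :
  (forall x, x \in A -> #|[set y in A | f y == f x]| = N) ->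
  (size (undup [seq f x | x in A]) * N)%N = #|A|.
Proof.
move=> fibre; set s := undup _.
rewrite -sum1_card.
rewrite (eq_bigr (fun x => \sum_(u <- s | f x == u) 1)%N); last first.
  move=> x xA; rewrite big_const_seq iter_addn_0 mul1n.
  rewrite (eq_count (a2 := pred1 (f x))); last by move=> u /=; rewrite eq_sym.
  by rewrite count_uniq_mem ?undup_uniq // mem_undup fintype.image_f.
rewrite (exchange_big_dep predT) //= big_seq (eq_bigr (fun=> N)); last first.
  move=> u; rewrite mem_undup => /mapP[x]; rewrite mem_enum => xA ->.
  by rewrite sum1_card -(fibre x xA); apply: eq_card => y; rewrite !inE.
by rewrite -big_seq big_const_seq iter_addn_0 count_predT mulnC.
Qed.

Lemma Zp_natr_eq (p a b : nat) : (1 < p)%N ->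
  ((a%:R : 'Z_p) == b%:R) = (a == b %[mod p])%N.
Proof. by move=> p_gt1; rewrite -val_eqE /= !val_Zp_nat. Qed.

Lemma order_Zp_natr (p a : nat) : (1 < p)%N -> (a %| p)%N ->
  #[a%:R : 'Z_p]%g = (p %/ a)%N.
Proof.
move=> p_gt1 /gcdn_idPr a_p.
by rewrite -[a%:R]FinRing.zmodXgE orderXgcd order_Zp1 Zp_cast // a_p.
Qed.

(** Bezout: the gcd is an integer combination of [a] and [b], and subgroups of ['Z_p] are stable
    under such combinations. *)
Lemma gcd_natr_mem (p : nat) (G : {group 'Z_p}) (a b : nat) : (1 < p)%N ->
  a%:R \in G -> b%:R \in G -> (gcdn a b)%:R \in G.
Proof.
move=> p_gt1 aG bG; have [->|a_gt0] := posnP a; first by rewrite gcd0n.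
have natG m c : c%:R \in G -> (m * c)%:R \in G.
  by move=> cG; rewrite natrM mulr_natl -FinRing.zmodXgE groupX.
have [u _ /dvdnP[q bezout]] := Bezoutl b a_gt0.
have -> : (gcdn a b)%:R = (q * a)%:R - (u * b)%:R :> 'Z_p.
  by rewrite -bezout natrD addrK.
by rewrite -FinRing.zmodMgE -FinRing.zmodVgE groupM ?groupV ?natG.
Qed.

(** * Exponent tuples as vectors over Z/d; counting solutions and orbits *)

Section Embedding.
Variables (n : nat) (w : 'I_n -> nat).
Local Notation d := (wdeg w).
Hypotheses (d_gt1 : (1 < d)%N) (w_gt0 : forall i, (0 < w i)%N)
  (w_dvd : forall i, (w i %| d)%N).

Lemma divw_gt0 i : (0 < d %/ w i)%N.
Proof. by rewrite divn_gt0 // dvdn_leq // ltnW. Qed.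

Lemma exptuple_mulw_lt (x : exptuple w) i : (x i * w i < d)%N.
Proof. by rewrite -ltn_divRL ?w_dvd. Qed.

(* The entry x_i mod d/w_i is recorded as x_i w_i mod d, which turns the varying
   moduli into subgroups of a single one. *)
Definition embed (x : exptuple w) : 'rV['Z_d]_n := \row_i (x i * w i)%:R.

Lemma embed_inj : injective embed.
Proof.
move=> x y /rowP exy; apply/ffunP => i; apply/val_inj/eqP => /=.
have /eqP := exy i; rewrite !mxE Zp_natr_eq // !modn_small ?exptuple_mulw_lt //.
by rewrite eqn_pmul2r.
Qed.

Lemma embed_surj (v : 'rV['Z_d]_n) :
  (forall i, v 0 i \in <[(w i)%:R : 'Z_d]>%g) -> exists x, embed x = v.
Proof.
move=> v_w; have t_ i : {t : nat | v 0 i = (t * w i)%:R}.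
  by apply/cid; have /cycleP[t ->] := v_w i; exists t;
    rewrite FinRing.zmodXgE natrM mulr_natl.
have lt_t i : (sval (t_ i) %% (d %/ w i) < d %/ w i)%N.
  by rewrite ltn_mod divw_gt0.
exists [ffun i => Ordinal (lt_t i)]; apply/rowP => i; rewrite mxE ffunE /=.
case: (t_ i) => t /= ->; apply/eqP; rewrite Zp_natr_eq //.
by rewrite muln_modl divnK // modn_mod.
Qed.

Lemma embed_cycle x i : embed x 0 i \in <[(w i)%:R : 'Z_d]>%g.
Proof.
apply/cycleP; exists (x i).
by rewrite mxE FinRing.zmodXgE natrM mulr_natl.
Qed.

(** The image of [embed] is the whole product of the subgroups generated by the [w i], so the coset
    of [G] through [embed z] lies inside it and pulls back bijectively. *)
Lemma card_embed_coset (z : exptuple w) (G : {group 'rV['Z_d]_n}) :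
  (forall v, v \in G -> forall i, v 0 i \in <[(w i)%:R : 'Z_d]>%g) ->
  #|[set x | embed x - embed z \in G]| = #|G|.
Proof.
move=> G_w; rewrite -(card_imset _ embed_inj) -(card_rcoset G (embed z)).
apply: eq_card => v; rewrite mem_rcoset; apply/imsetP/idP => [[x]|vG].
  by rewrite inE => xG ->.
have [i|x xv] := @embed_surj v; last by exists x; rewrite ?inE ?xv.
rewrite -[v](mulgKV (embed z)) FinRing.zmodMgE mxE.
by rewrite -FinRing.zmodMgE groupM ?embed_cycle // G_w.
Qed.

Variable k : nat.

Definition fixed_from (z : exptuple w) : {set exptuple w} :=
  [set x : exptuple w | [forall i : 'I_n, (k <= i)%N ==> (x i == z i)]].

Lemma card_fixed_from z :
  #|fixed_from z| = (\prod_(i < n | (i < k)%N) (d %/ w i))%N.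
Proof.
pose F i : pred 'I_(d %/ w i) := fun a => (k <= i)%N ==> (a == z i).
have -> : #|fixed_from z| = #|(family F : simpl_pred (exptuple w))|.
  by apply: eq_card => x; rewrite inE; apply/forallP/familyP.
rewrite card_family foldrE big_map enumT [RHS]big_mkcond /=.
apply: eq_bigr => i _; rewrite /F; case: ltnP => _.
  by rewrite (eq_card (B := predT)) ?card_ord.
by rewrite (eq_card (B := pred1 (z i))) ?card1.
Qed.

(** The subgroup of differences of embedded tuples that agree from index [k] on; each [fixed_from z]
    is a coset of it. *)
Definition box : {set 'rV['Z_d]_n} :=
  [set v : 'rV['Z_d]_n | [forall i : 'I_n,
     v 0 i \in (if (i < k)%N then <[(w i)%:R : 'Z_d]> else 1)%g]].

Lemma box_group_set : group_set box.
Proof.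
apply/group_setP; split=> [|u v]; rewrite !inE.
  by apply/forallP => i; rewrite mxE; case: ifP => _; apply: (group1 _).
move=> /forallP u_b /forallP v_b; apply/forallP => i; rewrite mxE.
by have := u_b i; have := v_b i; case: ifP => _ vi ui; apply: groupM.
Qed.
Canonical box_group := Group box_group_set.

Lemma box_cycle v i : v \in box -> v 0 i \in <[(w i)%:R : 'Z_d]>%g.
Proof.
by rewrite inE => /forallP/(_ i); case: ifP => // _ /set1P->; apply: group1.
Qed.

Lemma mem_fixed_from x z : (x \in fixed_from z) = (embed x - embed z \in box).
Proof.
rewrite !inE; apply: eq_forallb => i; rewrite mxE [(- embed z) 0 i]mxE.
case: ltnP => /= _.
  by rewrite -FinRing.zmodVgE -FinRing.zmodMgE groupM ?groupV ?embed_cycle.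
rewrite inE [1%g]/(0 : 'Z_d) subr_eq0 !mxE Zp_natr_eq //.
by rewrite !modn_small ?exptuple_mulw_lt // eqn_pmul2r.
Qed.

Lemma card_box : #|box| = (\prod_(i < n | (i < k)%N) (d %/ w i))%N.
Proof.
pose z : exptuple w := [ffun i => Ordinal (divw_gt0 i)].
rewrite -(card_fixed_from z) -(card_embed_coset z) /=; last first.
  by move=> v vb i; apply: box_cycle.
by apply: eq_card => x; rewrite mem_fixed_from inE.
Qed.

Variable c : 'I_n -> nat.
Hypothesis gcd_dvd : (gcd_first k (fun i => c i * w i)%N %| d)%N.
Local Notation g := (gcd_first k (fun i => c i * w i)%N).

Definition wpair (v : 'rV['Z_d]_n) : 'Z_d := \sum_i v 0 i * (c i)%:R.

Lemma wpairM : {in [set: 'rV['Z_d]_n] &, {morph wpair : u v / (u * v)%g}}.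
Proof.
move=> u v _ _; rewrite !FinRing.zmodMgE /wpair -big_split /=.
by apply: eq_bigr => i _; rewrite mxE mulrDl.
Qed.
Canonical wpair_morphism := Morphism wpairM.

(** Every value is a multiple of [g] because [g] divides each [c i * w i]. Conversely each
    [c i * w i] with [i < k] is a value, and the image, being a subgroup, then contains their
    gcd. *)
Lemma wpair_box : (wpair @* box)%g = <[g%:R : 'Z_d]>%g.
Proof.
apply/eqP; rewrite finset.eqEsubset; apply/andP; split.
  apply/fintype.subsetP => _ /morphimP[v _ v_b ->].
  apply: (big_ind (fun a => a \in <[g%:R : 'Z_d]>%g)).
  - exact: group1.
  - by move=> a b; apply: groupM.
  move=> i _; move: v_b; rewrite inE => /forallP/(_ i).
  case: ifP => [ik /cycleP[t ->]|_ /set1P->]; last by rewrite mul0r group1.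
  have /dvdnP[q cw] : (g %| c i * w i)%N by apply: biggcdn_inf (dvdnn _).
  apply/cycleP; exists (t * q)%N.
  rewrite !FinRing.zmodXgE -[_ *+ t]mulr_natr -[RHS]mulr_natr -!natrM.
  by rewrite mulnAC (mulnC (w i)) cw mulnC [in RHS]mulnCA (mulnC g).
rewrite cycle_subG /gcd_first.
apply: (big_ind (fun a => a%:R \in (wpair @* box)%g)).
- exact: group1.
- by move=> a b; apply: gcd_natr_mem.
(* The preimage is the vector of [box] with entry [w i] at [i] and 0 elsewhere. *)
move=> i ik; have -> : (c i * w i)%:R = wpair (\row_j ((j == i) * w i)%:R).
  rewrite /wpair (bigD1 i) //= mxE eqxx mul1n -natrM mulnC big1 ?addr0 // => j.
  by move=> /negPf ji; rewrite mxE ji mul0n mul0r.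
apply: mem_morphim; rewrite inE //; apply/forallP => j; rewrite mxE.
case: eqP => [->|_]; first by rewrite ik mul1n cycle_id.
by rewrite mul0n; case: ifP => _; apply: group1.
Qed.

(** For [c = 1] and [z] in [expM w] these are the elements of [expM w] with the last entries of [z];
    for [c = beta] they are the exponents of roots of unity whose action preserves the monomial of
    the family. *)
Definition solutions (z : exptuple w) : {set exptuple w} :=
  [set x in fixed_from z | d %| \sum_(i < n) x i * w i * c i]%N.

Lemma wpair_embed (x : exptuple w) :
  wpair (embed x) = (\sum_(i < n) x i * w i * c i)%:R.
Proof. by rewrite natr_sum; apply: eq_bigr => i _; rewrite mxE -natrM. Qed.

(** The solutions form a coset of the kernel of [wpair] on [box]. By Lagrange and the first
    isomorphism theorem this kernel has index [d / g], the order of the image. *)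
Lemma card_solutions z : z \in solutions z ->
  (#|solutions z| * d)%N = (g * \prod_(i < n | (i < k)%N) (d %/ w i))%N.
Proof.
have dvd_wpair (x : exptuple w) :
    (d %| \sum_(i < n) x i * w i * c i)%N = (wpair (embed x) == 0).
  by rewrite wpair_embed -[0]/(0%:R) Zp_natr_eq // mod0n.
rewrite inE => /andP[_]; rewrite dvd_wpair => /eqP fz.
have <- : #|(box :&: 'ker wpair)%g| = #|solutions z|.
  rewrite -(card_embed_coset z) => [|v /finset.setIP[vb _] i]; last first.
    exact: box_cycle.
  apply: eq_card => x; rewrite [in LHS]inE finset.in_setI -mem_fixed_from.
  rewrite [in RHS]inE dvd_wpair; congr (_ && _).
  rewrite (sameP (kerP wpair_morphism (finset.in_setT _)) eqP) /=.
  rewrite -FinRing.zmodVgE -FinRing.zmodMgE.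
  rewrite morphM ?inE // morphV ?inE //= fz.
  by rewrite FinRing.zmodMgE FinRing.zmodVgE subr0.
rewrite -card_box.
rewrite -(Lagrange (finset.subsetIl box ('ker wpair_morphism)%g)) mulnCA.
congr (_ * _)%N; have := card_morphim wpair_morphism box_group.
rewrite wpair_box finset.setTI /= -orderE order_Zp_natr // => order_g.
by rewrite indexgI /= -order_g mulnC divnK.
Qed.

Variable u : 'I_n -> nat.
Hypotheses (u_from : forall i : 'I_n, (k <= i)%N -> u i = 0%N)
  (u_dvd : (gcd_first k (fun i => u i * w i)%N %| d)%N)
  (u_sol : (d %| \sum_(i < n) u i * w i * c i)%N).
Local Notation h := (gcd_first k (fun i => u i * w i)%N).

Definition shift : 'rV['Z_d]_n := \row_i (u i * w i)%:R.

Lemma gcd_firstM (m : nat) :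
  (m * h)%N = gcd_first k (fun i => m * (u i * w i))%N.
Proof. exact: (big_morph _ (muln_gcdr m) (muln0 m)). Qed.

(** A multiple [m] kills [shift] iff [d] divides every [m * (u i * w i)], hence iff it divides their
    gcd [m * h]. *)
Lemma order_shift : #[shift]%g = (d %/ h)%N.
Proof.
have d_gt0 := ltnW d_gt1.
have h_gt0 : (0 < h)%N by apply: dvdn_gt0 u_dvd.
have dvdE m : (#[shift]%g %| m)%N = (d %/ h %| m)%N.
  rewrite order_dvdn FinRing.zmodXgE -(dvdn_pmul2r h_gt0) divnK // gcd_firstM.
  apply/eqP/dvdn_biggcdP => [/rowP um i _|um].
    have /eqP := um i; rewrite mulmxnE !mxE -[_ *+ m]mulr_natl -natrM.
    by rewrite -[0]/(0%:R) Zp_natr_eq // mod0n.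
  apply/rowP => i; rewrite mulmxnE !mxE -[_ *+ m]mulr_natl -natrM.
  apply/eqP; rewrite -[0]/(0%:R) Zp_natr_eq // mod0n.
  by have [/um//|/u_from->] := ltnP i k; rewrite mul0n muln0 mod0n.
by apply/eqP; rewrite eqn_dvd dvdE dvdnn -dvdE dvdnn.
Qed.

(** The hypothesis on [f] says that its fibres are the orbits of translation by [shift], all of size
    [d / h]. The factor [d * d] clears both denominators of [T_beta]. *)
Lemma size_solution_classes (U : eqType) (f : exptuple w -> U) z :
  z \in solutions z ->
  {in solutions z &, forall x y, f y = f x <->
     exists t, forall i,
       (y i * w i = x i * w i + t * (u i * w i) %[mod d])%N} ->
  (size (undup [seq f x | x in solutions z]) * (d * d)
     = g * h * \prod_(i < n | (i < k)%N) (d %/ w i))%N.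
Proof.
move=> zz fE; have d_gt0 := ltnW d_gt1.
have h_gt0 : (0 < h)%N by apply: dvdn_gt0 u_dvd.
have shiftE x y t : embed y = embed x + shift *+ t <->
    forall i, (y i * w i = x i * w i + t * (u i * w i) %[mod d])%N.
  split=> [/rowP e i|e].
    have /eqP := e i; rewrite !mxE mulmxnE !mxE -[_ *+ t]mulr_natl -natrM.
    by rewrite -natrD Zp_natr_eq // => /eqP.
  apply/rowP => i; rewrite !mxE mulmxnE !mxE -[_ *+ t]mulr_natl -natrM -natrD.
  by apply/eqP; rewrite Zp_natr_eq //; apply/eqP.
(* Translation by [shift] preserves the solutions: [u] vanishes from [k] on, and its pairing with
   [c] is 0 mod [d]. *)
have stable x t : x \in solutions z ->
    exists2 y, y \in solutions z & embed y = embed x + shift *+ t.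
  rewrite inE => /andP[]; rewrite inE => /forallP xz dx.
  have [|y yE] := @embed_surj (embed x + shift *+ t).
    move=> i; rewrite mxE -FinRing.zmodMgE groupM ?embed_cycle //.
    rewrite mulmxnE -FinRing.zmodXgE groupX // mxE natrM mulr_natl.
    by rewrite -FinRing.zmodXgE groupX // cycle_id.
  exists y => //; have /shiftE ye := yE; rewrite !inE; apply/andP; split.
    apply/forallP => i; apply/implyP => ki.
    have := ye i; rewrite (u_from ki) mul0n muln0 addn0.
    rewrite !modn_small ?exptuple_mulw_lt // => /eqP.
    rewrite eqn_pmul2r // => /eqP yx.
    by have := implyP (xz i) ki; rewrite -val_eqE /= -yx.
  have sumE : (\sum_(i < n) y i * w i * c i = \sum_(i < n) x i * w i * c i
      + t * \sum_(i < n) u i * w i * c i %[mod d])%N.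
    rewrite big_distrr -big_split /=; apply/eqP.
    rewrite -Zp_natr_eq // !natr_sum; apply/eqP/eq_bigr => i _.
    rewrite mulnA -mulnDl !natrM; congr (_ * _); apply/eqP.
    by rewrite -natrM Zp_natr_eq //; apply/eqP; rewrite ye.
  by rewrite /dvdn sumE -/(dvdn _ _) dvdn_add // dvdn_mull.
have fibre x : x \in solutions z ->
    #|[set y in solutions z | f y == f x]| = (d %/ h)%N.
  move=> xz; rewrite -order_shift orderE -(card_lcoset _ (embed x)).
  rewrite -(card_imset _ embed_inj); apply: eq_card => v.
  apply/imsetP/lcosetP => [[y] | [_ /cycleP[t ->] ->]].
    rewrite inE => /andP[yz /eqP/(fE x y xz yz)[t /shiftE ->]] ->.
    by exists (shift ^+ t)%g; rewrite ?mem_cycle // FinRing.zmodXgE.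
  have [y yz yE] := stable x t xz; exists y; last first.
    by rewrite yE FinRing.zmodXgE.
  rewrite inE yz /=; apply/eqP/(fE x y xz yz); exists t; exact/shiftE.
(* Splitting one factor [d] in this way isolates the fibre size [d / h]. *)
have dE : d = (d %/ h * h)%N by rewrite divnK.
rewrite {2}dE mulnCA !mulnA (mulnC d) -[(_ * d * _)%N]mulnAC.
by rewrite (size_undup_uniform fibre) card_solutions // mulnAC.
Qed.

End Embedding.

(** * Last entries and strong equivalence in terms of the embedding *)

Lemma last_entries_eq (n : nat) (w : 'I_n -> nat) (k : nat) (x z : exptuple w) :
  (last_entries k x == last_entries k z) = (x \in fixed_from k z).
Proof.
pose e (y : exptuple w) := [seq (y i : nat) | i : 'I_n].
have size_e y : size (e y) = n by rewrite size_map -cardE card_ord.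
have nth_e y (i : 'I_n) : nth 0%N (e y) i = y i.
  by rewrite (nth_map i) ?size_enum_ord // nth_ord_enum.
rewrite inE; apply/eqP/forallP => [xz i | xz].
  apply/implyP => ki; rewrite -val_eqE /= -!nth_e -(subnKC ki).
  by rewrite -!nth_drop -/(last_entries k x) -/(last_entries k z) xz.
apply: (@eq_from_nth _ 0%N) => [|j]; rewrite !size_drop ?size_e // => j_lt.
rewrite !nth_drop.
have kj_lt : (k + j < n)%N by rewrite -ltn_subRL.
have := implyP (xz (Ordinal kj_lt)) (leq_addr _ _).
by rewrite -val_eqE /= -!nth_e /= => /eqP.
Qed.

(** Multiplying by [w i] turns congruences mod [d / w i] into congruences mod [d]. There [t] matters
    only mod [d], so it can be taken to be a natural number. *)
Lemma strong_equivP (n : nat) (w : 'I_n -> nat) (beta x y : exptuple w) :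
  (forall i, 0 < w i)%N -> (forall i, w i %| wdeg w)%N -> (0 < wdeg w)%N ->
  strong_equiv beta x y <-> exists t : nat, forall i,
    (y i * w i = x i * w i + t * (beta i * w i) %[mod wdeg w])%N.
Proof.
move=> w_gt0 w_dvd d_gt0; set d := wdeg w.
have dvdE (t : int) i :
    ((y i)%:Z = (x i)%:Z + t * (beta i)%:Z %[mod (d %/ w i)%N%:Z])%Z <->
    (d%:Z %| (y i * w i)%N%:Z - ((x i * w i)%N%:Z + t * (beta i * w i)%N%:Z))%Z.
  have wi0 : (w i)%:Z != 0 by rewrite eqz_nat -lt0n.
  have -> : d%:Z = (d %/ w i)%N%:Z * (w i)%:Z by rewrite -PoszM divnK.
  rewrite !PoszM mulrA -mulrDl -mulrBl.
  rewrite dvdz_mul2r //; split=> [/eqP|]; first by rewrite eqz_mod_dvd.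
  by rewrite -eqz_mod_dvd => /eqP.
split=> [[t xy] | [t xy]].
  have r_ge0 : 0 <= (t %% d%:Z)%Z by rewrite modz_ge0 // eqz_nat -lt0n.
  exists `|(t %% d%:Z)%Z|%N => i.
  have /dvdE := xy i; rewrite {1}(divz_eq t d) => dvd_d; apply/eqP.
  rewrite -eqz_nat -!modz_nat eqz_mod_dvd PoszD (PoszM (absz _)) gez0_abs //.
  set q := (t %/ d)%Z in dvd_d *; set r := (t %% d)%Z in dvd_d *.
  rewrite (_ : _ - _ = (y i * w i)%N%:Z
      - ((x i * w i)%N%:Z + (q * d + r) * (beta i * w i)%N%:Z)
      + q * (beta i * w i)%N%:Z * d%:Z); last by ring.
  by rewrite rpredD // dvdz_mull.
exists t => i; apply/dvdE; rewrite -eqz_mod_dvd -PoszM -PoszD !modz_nat eqz_nat.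
exact/eqP.
Qed.

Lemma size_undup_image (T U : finType) (f : T -> U) (A : {set T}) :
  #|[set f x | x in A]| = size (undup [seq f x | x in A]).
Proof.
rewrite imset_card -(card_uniqP (undup_uniq _)).
by apply: eq_card => y; rewrite mem_undup.
Qed.

(** * The number of tuples and of strong classes with given last entries *)

Section Counting.
Variables (n : nat) (w : 'I_n -> nat).
Local Notation d := (wdeg w).
Hypotheses (w_gt0 : forall i, (0 < w i)%N) (w_dvd : forall i, (w i %| d)%N).
Variable k : nat.
Hypotheses (k_ge1 : (1 <= k)%N) (k_len : (k <= n)%N).
Variable beta : exptuple w.
Hypotheses (beta_M : beta \in expM w) (beta_l : lweight beta = 1%N)
  (beta_0 : forall i : 'I_n, (k <= i)%N -> beta i = 0%N :> nat).

Lemma wsum_beta : (\sum_(i < n) beta i * w i)%N = d.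
Proof.
by move: beta_M; rewrite inE => /divnK; rewrite -/(lweight _) beta_l mul1n.
Qed.

Lemma wdeg_gt0 : (0 < d)%N.
Proof.
have i0 : 'I_n by apply: (Ordinal (leq_trans k_ge1 k_len)).
by rewrite /wdeg (bigD1 i0) //= ltn_addr.
Qed.

(** If [d] were at most 1, each [beta i * w i], being less than [d], would be 0, although their sum
    is [d]. The bound matters because ['Z_d] is the ring of integers mod [d] only for [d > 1]. *)
Lemma wdeg_gt1 : (1 < d)%N.
Proof.
rewrite ltnNge; apply/negP => d_le1; have := wdeg_gt0.
rewrite -[X in (0 < X)%N]wsum_beta big1 // => i _; apply/eqP.
rewrite -leqn0 -ltnS.
by apply: leq_trans d_le1; apply: exptuple_mulw_lt.
Qed.

Lemma gcd_first_w_dvd : (gcd_first k w %| d)%N.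
Proof.
apply: dvdn_trans (w_dvd (Ordinal (leq_trans k_ge1 k_len))).
by apply: biggcdn_inf (dvdnn _).
Qed.

Lemma gcd_first_beta_dvd : (gcd_first k (fun i => beta i * w i)%N %| d)%N.
Proof.
rewrite -[X in (_ %| X)%N]wsum_beta; apply: dvdn_sum => i _.
have [ik|/beta_0->] := ltnP i k; last by rewrite mul0n.
by apply: biggcdn_inf (dvdnn _).
Qed.

Lemma prod_first_natr :
  prod_first w k = (\prod_(i < n | (i < k)%N) (d %/ w i))%:R.
Proof. by rewrite natr_prod; apply: eq_bigr => i _; rewrite natf_div. Qed.

Lemma T_betaE (N : nat) :
  (N * (d * d) = gcd_first k w * gcd_first k (fun i => beta i * w i)
     * \prod_(i < n | (i < k)%N) (d %/ w i))%N ->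
  N%:R = T_beta k beta.
Proof.
move=> NE; have d_neq0 : d%:R != 0 :> rat by rewrite pnatr_eq0 -lt0n wdeg_gt0.
have dd_neq0 : (d * d)%:R != 0 :> rat by rewrite natrM mulf_neq0.
apply: (mulIf dd_neq0); rewrite -natrM NE /T_beta prod_first_natr !natrM.
by field.
Qed.

Lemma eq_gcd_first (u v : 'I_n -> nat) :
  (forall i : 'I_n, (i < k)%N -> u i = v i) -> gcd_first k u = gcd_first k v.
Proof. exact: eq_bigr. Qed.

Lemma solutions1 (z : exptuple w) : z \in expM w ->
  solutions k (fun=> 1%N) z
    = [set x in expM w | last_entries k x == last_entries k z].
Proof.
move=> zM; apply/setP => x; rewrite !inE last_entries_eq andbC inE.
by congr (_ && _); under eq_bigr do rewrite muln1.
Qed.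

Lemma card_last_entries (z : exptuple w) : z \in expM w ->
  #|[set x in expM w | last_entries k x == last_entries k z]|%:R
    = (gcd_first k w)%:R / d%:R * prod_first w k.
Proof.
move=> zM; rewrite -solutions1 //.
have d_neq0 : d%:R != 0 :> rat by rewrite pnatr_eq0 -lt0n wdeg_gt0.
apply: (mulIf d_neq0); rewrite -natrM card_solutions ?wdeg_gt1 //.
- rewrite prod_first_natr natrM mulrAC divfK //; congr (_%:R * _).
  by apply: eq_gcd_first => i _; rewrite mul1n.
- by rewrite (eq_gcd_first (v := w)) ?gcd_first_w_dvd // => i _; rewrite mul1n.
by rewrite solutions1 // inE zM /=.
Qed.

Lemma strong_equiv_last (x y : exptuple w) :
  strong_equiv beta x y -> last_entries k x = last_entries k y.
Proof.
move=> /(strong_equivP _ _ _ w_gt0 w_dvd wdeg_gt0)[t xy]; apply/esym/eqP.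
rewrite last_entries_eq inE; apply/forallP => i; apply/implyP => ki.
have := xy i; rewrite beta_0 // mul0n muln0 addn0.
rewrite !modn_small ?exptuple_mulw_lt // => /eqP.
by rewrite eqn_pmul2r.
Qed.

Lemma strong_equiv_refl (x : exptuple w) : strong_equiv beta x x.
Proof. by exists 0 => i; rewrite mul0r addr0. Qed.

Lemma strong_equiv_sym (x y : exptuple w) :
  strong_equiv beta x y -> strong_equiv beta y x.
Proof.
move=> [t xy]; exists (- t) => i; apply/eqP.
rewrite -(eqz_modDr (t * (beta i)%:Z)) -addrA mulNr addNr addr0.
by apply/eqP; rewrite xy.
Qed.

Lemma strong_equiv_trans (x y z : exptuple w) :
  strong_equiv beta x y -> strong_equiv beta y z -> strong_equiv beta x z.
Proof.
move=> [t xy] [s yz]; exists (t + s) => i; rewrite yz mulrDl addrA.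
by apply/eqP; rewrite eqz_modDr xy.
Qed.

Lemma card_strong_classes (z : exptuple w) : z \in expM w ->
  #|[set C in strong_classes beta |
      [forall x in C, last_entries k x == last_entries k z]]|%:R
    = T_beta k beta.
Proof.
move=> zM; pose cls x := [set y in expM w | `[< strong_equiv beta x y >]].
pose A := solutions k (fun=> 1%N) z.
(* Last entries are constant on a strong class, so the classes to be counted are those of the
   elements of [A]. *)
have -> : [set C in strong_classes beta |
    [forall x in C, last_entries k x == last_entries k z]]
    = [set cls x | x in A].
  apply/setP => C; rewrite /A solutions1 //.
  apply/idP/imsetP => [|[x]]; rewrite inE.
    case/andP=> /imsetP[x xM ->] /forallP/(_ x) /implyP xz.
    exists x => //; rewrite inE xM xz // inE xM /=.
    exact/asboolP/strong_equiv_refl.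
  case/andP=> xM /eqP xz ->; rewrite inE; apply/andP; split.
    exact: imset_f.
  apply/forallP => y; apply/implyP.
  rewrite inE => /andP[_ /asboolP/strong_equiv_last <-].
  exact/eqP.
have clsE x y : x \in expM w -> y \in expM w ->
    cls y = cls x <-> strong_equiv beta x y.
  move=> xM yM; split=> [/setP/(_ y)|xy].
    rewrite inE in yM; rewrite !inE yM /=.
    case: asboolP => [_|[]]; last exact: strong_equiv_refl.
    by move=> /esym/asboolP.
  apply/setP => v; rewrite !inE; congr (_ && _); apply/asboolP/asboolP.
    exact: strong_equiv_trans.
  exact/strong_equiv_trans/strong_equiv_sym.
apply: T_betaE; rewrite size_undup_image.
rewrite -(eq_gcd_first (u := fun i => 1 * w i)%N) => [|i _]; last first.
  by rewrite mul1n.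
apply: (size_solution_classes _ w_gt0 w_dvd _ beta_0 _ _ (z := z)).
- exact: wdeg_gt1.
- by rewrite (eq_gcd_first (v := w)) ?gcd_first_w_dvd // => i _; rewrite mul1n.
- exact: gcd_first_beta_dvd.
- by under eq_bigr do rewrite muln1; rewrite wsum_beta.
- by rewrite solutions1 // inE zM /=.
move=> x y; rewrite solutions1 // !inE => /andP[xM _] /andP[yM _].
by rewrite clsE ?inE // strong_equivP ?wdeg_gt0.
Qed.

End Counting.

(** In characteristic 0 the polynomial ['X^p - 1] is separable, so over a closed field it has [p]
    distinct roots, and a group of [p] such roots of unity is cyclic. *)
Lemma prim_root_exists (C : numClosedFieldType) (p : nat) :
  (0 < p)%N -> exists z : C, p.-primitive_root z.
Proof.
move=> p_gt0; have [r] := closed_field_poly_normal ('X^p - 1 : {poly C}).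
rewrite (monicP _) ?monicXnsubC // scale1r => Dp.
have unity_r : all p.-unity_root r.
  by apply/allP => z; rewrite -root_prod_XsubC -Dp.
have size_r : (p < (size r).+1)%N.
  by rewrite -(size_prod_XsubC r id) -Dp size_XnsubC.
have [|z] := hasP (has_prim_root p_gt0 unity_r _ size_r); last by exists z.
by rewrite -separable_prod_XsubC -Dp separable_Xn_sub_1 // pnatr_eq0 -lt0n.
Qed.

(** * Equations of the singular points and their quasi-homogeneity *)

Section Singularities.
Variables (C : numClosedFieldType) (n : nat) (w : 'I_n -> nat).
Local Notation d := (wdeg w).
Hypotheses (w_gt0 : forall i, (0 < w i)%N) (w_dvd : forall i, (w i %| d)%N).
Variable k : nat.
Hypotheses (k_ge1 : (1 <= k)%N) (k_len : (k <= n)%N).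
Variable beta : exptuple w.
Hypotheses (beta_M : beta \in expM w) (beta_l : lweight beta = 1%N)
  (beta_0 : forall i : 'I_n, (k <= i)%N -> beta i = 0%N :> nat)
  (beta_neq0 : forall i : 'I_n, (i < k)%N -> beta i <> 0%N :> nat).
Variable a : C.
Local Notation F := (hypersurface_family k beta a).

Let d_gt0 : (0 < d)%N := wdeg_gt0 w_gt0 k_ge1 k_len.
Let d_gt1 : (1 < d)%N := wdeg_gt1 w_gt0 w_dvd k_ge1 k_len beta_M beta_l.
Let m_gt0 : forall i, (0 < d %/ w i)%N := divw_gt0 d_gt1 w_gt0 w_dvd.

Definition beta_prod (x : 'I_n -> C) : C := \prod_i x i ^+ beta i.

(** The partial derivatives multiplied by their variables: all equations become quasi-homogeneous of
    the same weighted degree [d]. *)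
Definition critical (x : 'I_n -> C) : Prop := forall i : 'I_n,
  (d %/ w i)%:R * x i ^+ (d %/ w i) + a * ((beta i)%:R * beta_prod x) = 0.

Lemma meval_mderiv_family (i : 'I_n) (x : 'I_n -> C) :
  (mderiv i F).@[x] = (d %/ w i)%:R * x i ^+ (d %/ w i).-1
    + a * ((beta i)%:R * \prod_j x j ^+ (beta j - (i == j))).
Proof.
pose b := [multinom (beta j : nat) | j < n].
have -> : F = \sum_(j < n) 'X_[U_(j) *+ (d %/ w j)] + a *: 'X_[b].
  rewrite /hypersurface_family; congr (_ + _ *: _).
    by apply: eq_bigr => j _; rewrite mpolyXn.
  rewrite mpolyXE_id big_mkcond; apply: eq_bigr => j _; rewrite mnmE.
  by case: ltnP => // /beta_0->.
rewrite linearD linearZ linear_sum /= mevalD mevalZ; congr (_ + _ * _).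
  rewrite (bigD1 i) //= big1 ?addr0 => [|j /negPf ji]; last first.
    by rewrite mderivX mulmnE mnmE ji mul0n scale0r.
  rewrite mderivX mulmnE mnmE eqxx mul1n mevalZ mevalX; congr (_ * _).
  rewrite (bigD1 i) //= mnmBE mulmnE mnmE eqxx mul1n subn1 big1 ?mulr1 // => j.
  by rewrite eq_sym => /negPf ji; rewrite mnmBE mulmnE mnmE ji mul0n.
rewrite mderivX mevalZ mevalX mnmE; congr (_ * _).
by apply: eq_bigr => j _; rewrite mnmBE !mnmE.
Qed.

Lemma euler_mderiv (i : 'I_n) (x : 'I_n -> C) :
  x i * (mderiv i F).@[x]
    = (d %/ w i)%:R * x i ^+ (d %/ w i) + a * ((beta i)%:R * beta_prod x).
Proof.
rewrite meval_mderiv_family mulrDr mulrCA -exprS prednK //; congr (_ + _).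
(* For [beta i = 0] the exponent [beta i - 1] is truncated to 0, but the coefficient [beta i] kills
   the term. *)
have [->|beta_gt0] := posnP (beta i); first by rewrite !mul0r !mulr0.
rewrite mulrCA [x i * _]mulrCA; congr (_ * (_ * _)).
rewrite /beta_prod (bigD1 i) //= [RHS](bigD1 i) //= eqxx subn1.
rewrite mulrA -exprS prednK //; congr (_ * _); apply: eq_bigr => j.
by rewrite eq_sym => /negPf->; rewrite subn0.
Qed.

Lemma critical_eq0 (x : 'I_n -> C) (i : 'I_n) :
  critical x -> (beta i)%:R * beta_prod x = 0 -> x i = 0.
Proof.
move=> cx bx; have := cx i; rewrite bx mulr0 addr0 => /eqP.
by rewrite mulf_eq0 pnatr_eq0 -leqn0 leqNgt m_gt0 expf_eq0 m_gt0 => /eqP.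
Qed.

Lemma critical_eq0_ge (x : 'I_n -> C) (i : 'I_n) :
  critical x -> (k <= i)%N -> x i = 0.
Proof. by move=> cx /beta_0 b0; apply: critical_eq0; rewrite // b0 mul0r. Qed.

(** If the product vanished, the equations would force every coordinate to be 0. *)
Lemma critical_prod_neq0 (x : 'I_n -> C) :
  critical x -> (exists i, x i != 0) -> beta_prod x != 0.
Proof.
move=> cx; case=> i; apply: contraNneq => bx.
by rewrite (critical_eq0 cx) // bx mulr0.
Qed.

Lemma critical_neq0 (x : 'I_n -> C) (i : 'I_n) :
  critical x -> (exists j, x j != 0) -> (i < k)%N -> x i != 0.
Proof.
move=> cx /(critical_prod_neq0 cx) bx ik; move: bx.
rewrite /beta_prod (bigD1 i) //= mulf_eq0 negb_or expf_eq0 negb_and -eqn0Ngt.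
by rewrite (introF eqP (beta_neq0 ik)) => /andP[].
Qed.

(** For [i < k] the coordinate is nonzero and can be cancelled; for [k <= i] it is 0, and so is the
    derivative, whose only term is a positive power of it. *)
Lemma critical_mderiv (x : 'I_n -> C) : (exists j, x j != 0) ->
  critical x <-> forall i, (mderiv i F).@[x] = 0.
Proof.
move=> x_neq0; split=> [cx i | dx i]; last by rewrite -euler_mderiv dx mulr0.
have [ik | ki] := ltnP i k.
  apply: (mulfI (critical_neq0 cx x_neq0 ik)).
  by rewrite euler_mderiv cx mulr0.
rewrite meval_mderiv_family (critical_eq0_ge cx ki) beta_0 // mul0r mulr0 addr0.
(* The weight of index 0 is a second positive summand of [d], since [0 < k <= i]. *)
have m_gt1 : (1 < d %/ w i)%N.
  rewrite ltn_divRL // mul1n /wdeg (bigD1 i) //=.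
  pose i0 := Ordinal (leq_trans k_ge1 k_len).
  have i0i : i0 != i.
    by apply: contraTneq ki => <-; rewrite -ltnNge.
  by rewrite (bigD1 i0) //= -addn1 leq_add2l ltn_addr.
by rewrite expr0n -subn1 subn_eq0 leqNgt m_gt1 mulr0.
Qed.

Lemma beta_prod_act (l : C) (x y : 'I_n -> C) :
  (forall i, y i = l ^+ w i * x i) -> beta_prod y = l ^+ d * beta_prod x.
Proof.
move=> yx; rewrite -[X in l ^+ X](wsum_beta beta_M beta_l).
rewrite expr_sum -big_split /=.
by apply: eq_bigr => i _; rewrite yx exprMn -exprM mulnC.
Qed.

Lemma critical_act (l : C) (x y : 'I_n -> C) :
  (forall i, y i = l ^+ w i * x i) -> critical x -> critical y.
Proof.
move=> yx cx i; rewrite (beta_prod_act yx) yx exprMn -exprM [(w i * _)%N]mulnC.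
rewrite divnK // -[RHS](mulr0 (l ^+ d)) -[in RHS](cx i); ring.
Qed.

Lemma punctured_neq0 (v : punctured C n) : exists i, \val v 0 i != 0.
Proof. by apply/rV0Pn; apply: (valP v). Qed.

Lemma wproj_piP (u v : punctured C n) : wproj_pi w u = wproj_pi w v <->
  exists l : C, l != 0 /\ forall i, \val v 0 i = l ^+ w i * \val u 0 i.
Proof.
split=> [/eqmodP/asboolP // | uv]; exact/eqmodP/asboolP.
Qed.

(** By [critical_act] the equations pass from one representative to all others. *)
Lemma singularitiesP (p : wproj C w) : singularities w F p <->
  exists2 v : punctured C n, critical (\val v 0) & wproj_pi w v = p.
Proof.
split=> [sing_p | [v cv <-] u uv i].
  have pE : wproj_pi w (repr p) = p by apply: reprK.
  exists (repr p) => //; apply/critical_mderiv; first exact: punctured_neq0.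
  exact: sing_p.
move: i; apply/critical_mderiv; first exact: punctured_neq0.
have /esym/wproj_piP[l [_ uv']] := uv; exact: critical_act uv' cv.
Qed.

(** * All singular points as twists of one of them by roots of unity *)

Section Orbit.
Variables (omega : C) (omega_prim : d.-primitive_root omega).
Variables (v : punctured C n) (v_crit : critical (\val v 0)).

Lemma omega_neq0 : omega != 0.
Proof.
apply/eqP => o0; have := prim_expr_order omega_prim.
by rewrite o0 expr0n gtn_eqF //= => /esym/eqP; rewrite oner_eq0.
Qed.

Lemma twist_subproof (e : exptuple w) :
  (\row_i (omega ^+ (e i * w i) * \val v 0 i)) != 0 :> 'rV[C]_n.
Proof.
have [i vi] := punctured_neq0 v; apply/rV0Pn; exists i.
by rewrite mxE mulf_neq0 // expf_neq0 // omega_neq0.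
Qed.

Definition twist (e : exptuple w) : punctured C n :=
  exist (fun x : 'rV[C]_n => x != 0) _ (twist_subproof e).

Lemma twistE (e : exptuple w) i :
  \val (twist e) 0 i = omega ^+ (e i * w i) * \val v 0 i.
Proof. by rewrite mxE. Qed.

Lemma beta_prod_twist (e : exptuple w) : beta_prod (\val (twist e) 0)
  = omega ^+ (\sum_i e i * w i * beta i) * beta_prod (\val v 0).
Proof.
rewrite expr_sum -big_split /=; apply: eq_bigr => i _.
by rewrite mxE exprMn -exprM.
Qed.

Definition exptuple0 : exptuple w := [ffun i => Ordinal (m_gt0 i)].

Local Notation A := (solutions k (fun i => beta i : nat) exptuple0).

Lemma mem_twist_exponents (e : exptuple w) : e \in A ->
  (forall i : 'I_n, (k <= i)%N -> e i = 0%N :> nat) /\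
  omega ^+ (\sum_i e i * w i * beta i) = 1.
Proof.
rewrite !inE => /andP[/forallP e0]; rewrite (prim_order_dvd omega_prim).
move=> /eqP->; split=> // i ki.
by have := implyP (e0 i) ki; rewrite ffunE => /eqP->.
Qed.

Lemma critical_twist (e : exptuple w) :
  e \in A -> critical (\val (twist e) 0).
Proof.
move=> /mem_twist_exponents[_ e1] i; rewrite beta_prod_twist e1 mul1r twistE.
rewrite exprMn -exprM -mulnA [(w i * _)%N]mulnC divnK // mulnC exprM.
by rewrite (prim_expr_order omega_prim) expr1n mul1r v_crit.
Qed.

Lemma twist_surj (u : punctured C n) : critical (\val u 0) ->
  exists2 e, e \in A & wproj_pi w (twist e) = wproj_pi w u.
Proof.
move=> cu; have bu := critical_prod_neq0 cu (punctured_neq0 u).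
have bv := critical_prod_neq0 v_crit (punctured_neq0 v).
(* The monomial has weighted degree [d], so rescaling by this [l] gives [u] the monomial value of
   [v]. *)
pose l := d.-root (beta_prod (\val v 0) / beta_prod (\val u 0)).
have l_d : l ^+ d = beta_prod (\val v 0) / beta_prod (\val u 0).
  exact: rootCK.
have l_neq0 : l != 0.
  apply: contra_neq (mulf_neq0 bv (invr_neq0 bu)) => l0.
  by rewrite -l_d l0 expr0n gtn_eqF.
pose x i := l ^+ w i * \val u 0 i.
have cx : critical x by apply: critical_act cu.
have bx : beta_prod x = beta_prod (\val v 0).
  by rewrite (beta_prod_act (fun=> erefl)) l_d divfK.
have [i | e eP] := @fin_all_exists _ _ (fun i (j : 'I_(d %/ w i)) =>
    x i = omega ^+ (j * w i) * \val v 0 i /\ ((k <= i)%N -> j = 0%N :> nat)).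
  have [ik | ki] := ltnP i k; last first.
    exists (Ordinal (m_gt0 i)); split=> //=.
    by rewrite (critical_eq0_ge cx ki) (critical_eq0_ge v_crit ki) mulr0.
  have vi := critical_neq0 v_crit (punctured_neq0 v) ik.
  have m_prim := dvdn_prim_root omega_prim (dvdn_div (w_dvd i)).
  (* With equal monomial values, the equations for [x] and [v] give equal [d / w i]-th powers of
     their coordinates. *)
  have xv : (x i / \val v 0 i) ^+ (d %/ w i) = 1.
    have m_neq0 : (d %/ w i)%:R != 0 :> C by rewrite pnatr_eq0 -lt0n.
    rewrite exprMn exprVn; apply: (mulIf (expf_neq0 (d %/ w i) vi)).
    rewrite divfK ?expf_neq0 // mul1r; apply: (mulfI m_neq0).
    apply: (addIr (a * ((beta i)%:R * beta_prod x))).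
    by rewrite cx bx v_crit.
  have [j xj] := prim_rootP m_prim xv; exists j; split=> //.
  rewrite -(divfK vi (x i)) xj -exprM mulnC; congr (_ ^+ (_ * _) * _).
  by rewrite -{1}(divnK (w_dvd i)) mulKn.
have ve : \val (twist (finfun e)) 0 =1 x.
  by move=> i; rewrite twistE ffunE; have [-> _] := eP i.
exists (finfun e : exptuple w).
  rewrite !inE; apply/andP; split.
    apply/forallP => i; apply/implyP => ki; rewrite !ffunE -val_eqE /=.
    by have [_ ->] := eP i.
  rewrite (prim_order_dvd omega_prim); apply/eqP/(mulIf bv).
  rewrite -beta_prod_twist mul1r -bx; apply: eq_bigr => i _; by rewrite ve.
apply/esym/wproj_piP; exists l; split=> // i; exact: ve.
Qed.

Lemma twist_eq : {in A &, forall e e' : exptuple w,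
  wproj_pi w (twist e') = wproj_pi w (twist e) <-> exists t, forall i : 'I_n,
    (e' i * w i = e i * w i + t * ((i < k) * w i) %[mod d])%N}.
Proof.
move=> e e' eA e'A; have [e0 _] := mem_twist_exponents eA.
have [e'0 _] := mem_twist_exponents e'A.
have v_neq0 (i : 'I_n) := critical_neq0 v_crit (punctured_neq0 v) (i := i).
split=> [/esym/wproj_piP[l [_ ee']] | [t ee']].
  have {}ee' (i : 'I_n) : (i < k)%N ->
      omega ^+ (e' i * w i) = l ^+ w i * omega ^+ (e i * w i).
    by move=> ik; apply: (mulIf (v_neq0 i ik)); rewrite -mulrA -!twistE.
  (* Raising the relation at index 0 to the power [d / w i0] turns the powers of [omega] into 1 and
     leaves [l ^+ d]. *)
  have l_d : l ^+ d = 1.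
    pose i0 := Ordinal (leq_trans k_ge1 k_len).
    have := congr1 (fun y => y ^+ (d %/ w i0)) (ee' i0 k_ge1).
    rewrite exprMn -!exprM -!mulnA [(w i0 * _)%N]mulnC divnK // -!(mulnC d).
    by rewrite !exprM (prim_expr_order omega_prim) !expr1n mulr1.
  have [t lE] := prim_rootP omega_prim l_d; exists t => i.
  have [ik | ki] := ltnP i k; last by rewrite e0 // e'0 // mul0n muln0.
  apply/eqP; rewrite -(eq_prim_root_expr omega_prim) ee' // lE mul1n.
  by rewrite -exprM -exprD addnC.
apply/esym/wproj_piP; exists (omega ^+ t); split=> [|i].
  by rewrite expf_neq0 // omega_neq0.
rewrite !twistE; have [ik | ki] := ltnP i k; last first.
  by rewrite (critical_eq0_ge v_crit ki) !mulr0.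
rewrite mulrA; congr (_ * _); rewrite -exprM -exprD addnC; apply/eqP.
by rewrite (eq_prim_root_expr omega_prim); apply/eqP; rewrite ee' ik mul1n.
Qed.

End Orbit.

Lemma card_singularities : (singularities w F !=set0)%classic ->
  finite_set (singularities w F) /\
  (#|` fset_set (singularities w F)|)%:R = T_beta k beta.
Proof.
move=> [_ /singularitiesP[v v_crit _]].
have [omega omega_prim] := @prim_root_exists C d d_gt0.
pose A := solutions k (fun i => beta i : nat) exptuple0.
pose s := [seq wproj_pi w (twist omega_prim v e) | e in A].
(* Listing the singular points as twists gives finiteness and, through [card_fseq], a cardinality in
   the form handled by the orbit count. *)
have -> : singularities w F = [set` [fset p in s]%fset]%classic.
  apply/seteqP; split=> p /=; rewrite inE.
    move=> /singularitiesP[u cu <-].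
    have [e eA <-] := twist_surj omega_prim v_crit cu.
    by apply/fintype.imageP; exists e.
  move=> /fintype.imageP[e eA ->]; apply/singularitiesP.
  by exists (twist omega_prim v e) => //; apply: critical_twist.
split; first exact: finite_fset.
rewrite set_fsetK card_fseq; apply: T_betaE => //.
rewrite [(gcd_first k w * _)%N]mulnC.
have gcdE : gcd_first k (fun i => (i < k)%N * w i)%N = gcd_first k w.
  by apply: eq_gcd_first => i ->; rewrite mul1n.
rewrite -[X in (_ * X * _)%N]gcdE.
apply: (size_solution_classes d_gt1 w_gt0 w_dvd _ _ _ _ (z := exptuple0)).
- exact: gcd_first_beta_dvd.
- by move=> i; rewrite leqNgt => /negPf->.
- by rewrite gcdE gcd_first_w_dvd.
- rewrite (eq_bigr (fun i => beta i * w i)%N) => [|i _].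
    by rewrite (wsum_beta beta_M beta_l).
  by have [_|/beta_0->] := ltnP i k; rewrite ?muln0 // mul1n mulnC.
- rewrite !inE; apply/andP; split.
    by apply/forallP => i; rewrite eqxx implybT.
  by rewrite big1 ?dvdn0 // => i _; rewrite ffunE.
exact: twist_eq.
Qed.

End Singularities.

Theorem corollary13 (R : realType) (n : nat) (w : 'I_n -> nat)
    (w_gt0 : forall i, (0 < w i)%N)
    (w_dvd : forall i, (w i %| wdeg w)%N)
    (w_gcd : \big[gcdn/0%N]_(i < n) w i = 1%N)
    (k : nat) (k_ge1 : (1 <= k)%N) (k_len : (k <= n)%N)
    (beta : exptuple w) (beta_M : beta \in expM w) (beta_l : lweight beta = 1%N)
    (beta_0 : forall i : 'I_n, (k <= i)%N -> beta i = 0%N :> nat) :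
  (forall tau : seq nat, (exists2 z, z \in expM w & last_entries k z = tau) ->
     (#|[set x in expM w | last_entries k x == tau]|)%:R
       = (gcd_first k w)%:R / (wdeg w)%:R * prod_first w k
     /\
     (#|[set C in strong_classes beta | [forall x in C, last_entries k x == tau]]|)%:R
       = T_beta k beta)
  /\
  ((forall i : 'I_n, (i < k)%N -> beta i <> 0%N :> nat) ->
   forall a : R[i],
     (singularities w (hypersurface_family k beta a) !=set0)%classic ->
     finite_set (singularities w (hypersurface_family k beta a)) /\
     (#|` fset_set (singularities w (hypersurface_family k beta a))|)%:R = T_beta k beta).
Proof.
split=> [tau [z zM <-] | beta_neq0 a].
  split; last exact: card_strong_classes.
  exact: (card_last_entries _ _ k_ge1 k_len beta_M beta_l).
exact: card_singularities.
Qed.
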